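(* Let $R$ be a domain and let $\mathcal{M}$ be an $R$-matroid of rank $r$ on the ground set $[n]$, with Tutte polynomial $T_{\mathcal{M}}(x,y)$ and Grothendieck $f$-vector $(f_{-1},f_0,\dots,f_{r-1})$. Then the $f$-polynomial $f_{\mathcal{M}}(t)=\sum_{i=0}^r f_{i-1}(t-1)^{r-i}$ is a specialization of the Tutte polynomial, namely \[ T_{\mathcal{M}}(t,1)=\sum_{i=0}^r f_{i-1}(t-1)^{r-i}. \] Moreover, \[ \frac{t^r}{(1-t)^r}\,T_{\mathcal{M}}\left(\tfrac1t,1\right)=\sum_{i=0}^r f_{i-1}\frac{t^i}{(1-t)^i}. \]
   Context: $[n]=\{1,\dots,n\}$; $R$ is a (commutative) domain with field of fractions $Q(R)$; $R$-mod is the category of finitely generated $R$-modules. An $R$-matroid on $[n]$ is a function $\mathcal{M}:2^{[n]}\to R\text{-mod}$ (values matter up to isomorphism) such that for every $A\subseteq[n]$ and $b,c\in[n]\setminus A$ there are $x,y\in\mathcal{M}(A)$ with $\mathcal{M}(A\cup\{b\})\simeq\mathcal{M}(A)/(x)$, $\mathcal{M}(A\cup\{c\})\simeq\mathcal{M}(A)/(y)$, $\mathcal{M}(A\cup\{b,c\})\simeq\mathcal{M}(A)/(x,y)$. The generic matroid of $\mathcal{M}$ is the classical matroid on $[n]$ with rank function $\operatorname{rk}(A)=\dim_{Q(R)}(\mathcal{M}(\emptyset)\otimes_R Q(R))-\dim_{Q(R)}(\mathcal{M}(A)\otimes_R Q(R))$; the rank of $\mathcal{M}$ is $r=\operatorname{rk}([n])$.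 $\Delta\mathcal{M}$ is the simplicial complex of its independent sets: $A\in\Delta\mathcal{M}$ iff $\operatorname{rk}(A)=|A|$. $\operatorname{tor}(A)$ is the torsion submodule of $\mathcal{M}(A)$ and $N^\vee=\operatorname{Hom}_R(N,Q(R)/R)$. $L_0(R\text{-mod})$ is the commutative ring freely generated as an abelian group by isomorphism classes $[N]$ of finitely generated $R$-modules, with product $[N][N']=[N\oplus N']$. It is understood that the modules $\operatorname{tor}(A)^\vee$ are finitely generated, so that $[\operatorname{tor}(A)^\vee]\in L_0(R\text{-mod})$. The Tutte polynomial is $T_{\mathcal{M}}(x,y)=\sum_{A\subseteq[n]}[\operatorname{tor}(A)^\vee](x-1)^{r-\operatorname{rk}(A)}(y-1)^{|A|-\operatorname{rk}(A)}\in L_0(R\text{-mod})[x,y]$. The Grothendieck $f$-vector is $(f_{-1},\dots,f_{r-1})$ with $f_{i-1}=\sum_{A\in\Delta\mathcal{M},\,|A|=i}[\operatorname{tor}(A)^\vee]\in L_0(R\text{-mod})$ for $0\le i\le r$. *)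

(* Defs.v *)
From HB Require Import structures.
From mathcomp Require Import all_boot all_order all_algebra.
From mathcomp Require Import generic_quotient ring_quotient fraction.
From mathcomp Require Import boolp classical_sets functions.
From mathcomp Require Import monalg mpoly.

Set Implicit Arguments.
Unset Strict Implicit.
Unset Printing Implicit Defensive.

Import GRing.Theory.
Local Open Scope ring_scope.
Local Open Scope quotient_scope.

Section Span.
Context (R : nzRingType) (V : lmodType R).
Implicit Types S : set V.

Definition span S : {pred V} := fun v =>
  `[< exists n (e : 'I_n -> V) (c : 'I_n -> R),
        (forall i, S (e i)) /\ v = \sum_(i < n) c i *: e i >].

Lemma spanP S v : reflect
  (exists n (e : 'I_n -> V) (c : 'I_n -> R),
     (forall i, S (e i)) /\ v = \sum_(i < n) c i *: e i)
  (v \in span S).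
Proof. exact: asboolP. Qed.

Fact span_submod_closed S : submod_closed (span S).
Proof.
split=> [|a u v].
  apply/spanP; exists 0%N, (fun=> 0), (fun=> 0).
  by split=> [[]//|]; rewrite big_ord0.
move=> /spanP[m [e [c [Se ->]]]] /spanP[k [e' [c' [Se' ->]]]].
apply/spanP; exists (m + k)%N.
exists (fun i : 'I_(m + k) => match fintype.split i with inl j => e j | inr j => e' j end).
exists (fun i : 'I_(m + k) => match fintype.split i with inl j => a * c j | inr j => c' j end).
split=> [i|]; first by case: (fintype.split i).
rewrite big_split_ord /= scaler_sumr; congr (_ + _); apply: eq_bigr => i _.
  by rewrite (unsplitK (inl i)) scalerA.
by rewrite (unsplitK (inr i)).
Qed.

HB.instance Definition _ S :=
  GRing.isSubmodClosed.Build R V (span S) (span_submod_closed S).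

Lemma span_incl S v : S v -> v \in span S.
Proof.
move=> Sv; apply/spanP; exists 1%N, (fun=> v), (fun=> 1).
by split=> //; rewrite big_ord1 scale1r.
Qed.

Lemma span_min S (W : submodClosed V) :
  (forall v, S v -> v \in W) -> {subset span S <= W}.
Proof.
move=> SW _ /spanP[n [e [c [Se ->]]]].
by apply: rpred_sum => i _; apply: rpredZ; apply: SW.
Qed.

Definition finitely_generated : Prop :=
  exists n (e : 'I_n -> V), forall v, v \in span (range e).

End Span.
Arguments finitely_generated {R} V.

Section QuotientModule.
Context (R : nzRingType) (V : lmodType R) (S : set V).

Definition quotmod := (Quotient.quot (span S)).
HB.instance Definition _ := GRing.Zmodule.on quotmod.
HB.instance Definition _ :=
  EqQuotient.copy quotmod (Quotient.quot (span S)).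

Definition quotmod_scale (a : R) (q : quotmod) : quotmod :=
  \pi_quotmod (a *: repr q).

Lemma pi_quotmodE (u v : V) :
  (\pi_quotmod u == \pi_quotmod v) = (u - v \in span S).
Proof. by rewrite -[LHS]/(u == v %[mod (Quotient.quot (span S))]) -Quotient.idealrBE. Qed.

Lemma pi_quotmodD : {morph \pi_quotmod : u v / u + v}.
Proof. exact: (raddfD (\pi_(Quotient.quot (span S)))). Qed.

Lemma pi_quotmodZ a : {morph \pi_quotmod : u / a *: u >-> quotmod_scale a u}.
Proof.
move=> u; apply/eqP; rewrite pi_quotmodE -scalerBr rpredZ //.
by rewrite -pi_quotmodE reprK.
Qed.

Fact quotmod_surj (q : quotmod) : exists u, q = \pi_quotmod u.
Proof. by exists (repr q); rewrite reprK. Qed.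

Fact quotmod_scaleA a b q :
  quotmod_scale a (quotmod_scale b q) = quotmod_scale (a * b) q.
Proof. by have [u ->] := quotmod_surj q; rewrite -!pi_quotmodZ scalerA. Qed.
Fact quotmod_scale1 : left_id 1 quotmod_scale.
Proof. by move=> q; have [u ->] := quotmod_surj q; rewrite -pi_quotmodZ scale1r. Qed.
Fact quotmod_scaleDr : right_distributive quotmod_scale +%R.
Proof.
move=> a q q'; have [u ->] := quotmod_surj q; have [v ->] := quotmod_surj q'.
by rewrite -pi_quotmodD -!pi_quotmodZ -pi_quotmodD scalerDr.
Qed.
Fact quotmod_scaleDl q : {morph quotmod_scale^~ q : a b / a + b}.
Proof.
move=> a b; have [u ->] := quotmod_surj q.
by rewrite -!pi_quotmodZ -pi_quotmodD scalerDl.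
Qed.

HB.instance Definition _ := GRing.Zmodule_isLmodule.Build R quotmod
  quotmod_scaleA quotmod_scale1 quotmod_scaleDr quotmod_scaleDl.

Definition quotmod_pi (v : V) : quotmod := \pi_quotmod v.

Fact quotmod_pi_is_linear : linear quotmod_pi.
Proof. by move=> a u v; rewrite /quotmod_pi pi_quotmodD pi_quotmodZ. Qed.
HB.instance Definition _ :=
  GRing.isLinear.Build R V quotmod *:%R quotmod_pi quotmod_pi_is_linear.

End QuotientModule.

Definition isomorphic (R : nzRingType) (U V : lmodType R) : Prop :=
  exists f : {linear U -> V}, bijective f.

Section Torsion.
Context (R : idomainType) (N : lmodType R).

Definition torsion : {pred N} := fun v =>
  `[< exists2 r : R, r != 0 & r *: v = 0 >].

Fact torsion_submod_closed : submod_closed torsion.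
Proof.
split=> [|a u v]; first by apply/asboolP; exists 1; rewrite ?oner_eq0 ?scaler0.
move=> /asboolP[r r0 ru] /asboolP[s s0 sv]; apply/asboolP; exists (r * s).
  by rewrite mulf_neq0.
rewrite scalerDr -(scalerA r s v) sv scaler0 addr0 scalerA -mulrA mulrC.
by rewrite -scalerA ru scaler0.
Qed.
HB.instance Definition _ :=
  GRing.isSubmodClosed.Build R N torsion torsion_submod_closed.

Definition tor := {v : N | v \in torsion}.
HB.instance Definition _ := SubChoice.on tor.
HB.instance Definition _ := [SubChoice_isSubLmodule of tor by <:].

End Torsion.

Section Hom.
Context (R : comNzRingType) (U V : lmodType R).

Definition linear_pred : {pred U -> V} := fun f => `[< linear f >].

Fact linear_pred_submod_closed : submod_closed linear_pred.
Proof.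
split=> [|a f g /asboolP lf /asboolP lg]; apply/asboolP => b u v /=.
  by rewrite -[LHS]/(0 : V) -[X in _ *: X + _]/(0 : V) scaler0 add0r.
rewrite -[LHS]/(a *: f (b *: u + v) + g (b *: u + v)).
rewrite -[X in _ = b *: X + _]/(a *: f u + g u) -[X in _ = _ + X]/(a *: f v + g v).
rewrite lf lg !scalerDr !scalerA [b * a]mulrC -!addrA; congr (_ + _).
by rewrite addrCA.
Qed.
HB.instance Definition _ :=
  GRing.isSubmodClosed.Build R (U -> V) linear_pred linear_pred_submod_closed.

Definition Hom := {f : U -> V | f \in linear_pred}.
HB.instance Definition _ := SubChoice.on Hom.
HB.instance Definition _ := [SubChoice_isSubLmodule of Hom by <:].

End Hom.

Section FractionModule.
Context (R : idomainType).

(* Q(R) regarded as an R-module. *)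
Definition fraction_mod : Type := {fraction R}.
HB.instance Definition _ := GRing.Zmodule.on fraction_mod.

Definition fraction_mod_scale (a : R) (q : fraction_mod) : fraction_mod :=
  (tofrac a : {fraction R}) * (q : {fraction R}).

Fact fraction_mod_scaleA a b q :
  fraction_mod_scale a (fraction_mod_scale b q) = fraction_mod_scale (a * b) q.
Proof. by rewrite /fraction_mod_scale rmorphM mulrA. Qed.
Fact fraction_mod_scale1 : left_id 1 fraction_mod_scale.
Proof. by move=> q; rewrite /fraction_mod_scale rmorph1 mul1r. Qed.
Fact fraction_mod_scaleDr : right_distributive fraction_mod_scale +%R.
Proof. by move=> a p q; rewrite /fraction_mod_scale -mulrDr. Qed.
Fact fraction_mod_scaleDl q : {morph fraction_mod_scale^~ q : a b / a + b}.
Proof. by move=> a b; rewrite /fraction_mod_scale rmorphD mulrDl. Qed.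

HB.instance Definition _ := GRing.Zmodule_isLmodule.Build R fraction_mod
  fraction_mod_scaleA fraction_mod_scale1
  fraction_mod_scaleDr fraction_mod_scaleDl.

(* Q(R)/R *)
Definition fraction_quot : lmodType R :=
  quotmod (range (@tofrac R) : set fraction_mod).

End FractionModule.

(* N^\vee = Hom_R(N, Q(R)/R) *)
Definition dual (R : idomainType) (N : lmodType R) : lmodType R :=
  Hom N (fraction_quot R).

Section TensorFraction.
Context (R : idomainType) (N : lmodType R).
Local Notation Q := {fraction R}.

(* N \otimes_R Q(R) as a Q(R)-vector space: generated by the symbols         *)
(* u \otimes q, modulo R-bilinearity and p (u \otimes q) = u \otimes (p q)   *)
(* for p in Q(R).                                                            *)
Definition tensor_symb (u : N) (q : Q) : {malg Q[(N * Q)%type]} := << (u, q) >>.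
Local Notation sym := tensor_symb.

Inductive tensor_rel : set {malg Q[(N * Q)%type]} :=
| TensorDl u v q : tensor_rel (sym (u + v) q - sym u q - sym v q)
| TensorDr u p q : tensor_rel (sym u (p + q) - sym u p - sym u q)
| TensorZ a u q : tensor_rel (sym (a *: u) q - sym u (tofrac a * q))
| TensorM p u q : tensor_rel (sym u (p * q) - p *: sym u q).

Definition tensor_fraction : lmodType Q := quotmod tensor_rel.

End TensorFraction.

Section Dimension.
Context (K : fieldType) (V : lmodType K).

Definition is_basis n (e : 'I_n -> V) : Prop :=
  forall v, exists! c : 'rV[K]_n, v = \sum_(i < n) c 0 i *: e i.

(* The value is 0 when V is not finite-dimensional. *)
Definition dimension : nat :=
  xget 0%N [set n | exists e : 'I_n -> V, is_basis e]%classic.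

End Dimension.

Record fgmodType (R : nzRingType) := FgMod {
  fgmod_sort :> lmodType R;
  fgmodP : finitely_generated fgmod_sort
}.

Section Isomorphic.
Context (R : nzRingType).
Implicit Types U V W : lmodType R.

Lemma isomorphic_refl U : isomorphic U U.
Proof. by exists (idfun : {linear U -> U}); exists idfun. Qed.

Lemma isomorphic_sym U V : isomorphic U V -> isomorphic V U.
Proof.
move=> [f [g fK gK]].
have lg : linear g by move=> a u v; apply: (can_inj fK); rewrite linearP !gK.
pose gL := GRing.isLinear.Build R V U *:%R g lg.
by exists (HB.pack_for {linear V -> U} g gL); exists f.
Qed.

Lemma isomorphic_trans U V W :
  isomorphic U V -> isomorphic V W -> isomorphic U W.
Proof.
move=> [f bf] [g bg]; exists (g \o f : {linear U -> W}).
exact: bij_comp.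
Qed.

Lemma isomorphic_prod U U' V V' : isomorphic U U' -> isomorphic V V' ->
  isomorphic (U * V)%type (U' * V')%type.
Proof.
move=> [f [f' fK f'K]] [g [g' gK g'K]].
pose h (w : U * V) : U' * V' := (f w.1, g w.2).
have lh : linear h by move=> a u v; rewrite /h /= !linearP.
pose hL := GRing.isLinear.Build R (U * V)%type (U' * V')%type *:%R h lh.
exists (HB.pack_for {linear (U * V)%type -> (U' * V')%type} h hL).
exists (fun w => (f' w.1, g' w.2)) => [[u v]|[u v]] /=.
  by rewrite /h /= fK gK.
by rewrite /h /= f'K g'K.
Qed.

Lemma isomorphic_prodA U V W :
  isomorphic (U * (V * W))%type ((U * V) * W)%type.
Proof.
pose h (w : U * (V * W)) : (U * V) * W := ((w.1, w.2.1), w.2.2).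
have lh : linear h by [].
pose hL := GRing.isLinear.Build R (U * (V * W))%type ((U * V) * W)%type *:%R h lh.
exists (HB.pack_for {linear (U * (V * W))%type -> ((U * V) * W)%type} h hL).
by exists (fun w => (w.1.1, (w.1.2, w.2))) => [[u [v w]]|[[u v] w]].
Qed.

Lemma isomorphic_prodC U V : isomorphic (U * V)%type (V * U)%type.
Proof.
pose h (w : U * V) : V * U := (w.2, w.1).
have lh : linear h by [].
pose hL := GRing.isLinear.Build R (U * V)%type (V * U)%type *:%R h lh.
exists (HB.pack_for {linear (U * V)%type -> (V * U)%type} h hL).
by exists (fun w => (w.2, w.1)) => [[u v]|[u v]].
Qed.

Lemma isomorphic_prod0 U : isomorphic ('rV[R]_0 * U)%type U.
Proof.
pose h (w : 'rV[R]_0 * U) : U := w.2.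
have lh : linear h by [].
pose hL := GRing.isLinear.Build R ('rV[R]_0 * U)%type U *:%R h lh.
exists (HB.pack_for {linear ('rV[R]_0 * U)%type -> U} h hL).
by exists (fun u => (0, u)) => [[u v]|u] //; rewrite [u]thinmx0.
Qed.

Lemma isomorphic_prod_eq0 U V :
  isomorphic (U * V)%type 'rV[R]_0 -> isomorphic U 'rV[R]_0.
Proof.
move=> [f [f' fK _]].
exists (\0 : {linear U -> 'rV[R]_0}); exists (fun=> 0) => u; last by rewrite [u]thinmx0.
have : f (u, 0) = f (0, 0) by rewrite [LHS]thinmx0 [RHS]thinmx0.
by move=> /(can_inj fK) [->].
Qed.

Lemma quotmod_kernel U V (f : {linear U -> V}) : (forall v, exists u, f u = v) ->
  isomorphic (quotmod (fun u => f u = 0)) V.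
Proof.
move=> fsurj; set S := fun u => f u = 0.
have kerf u : u \in span S -> f u = 0.
  move=> /spanP[n [e [c [Se ->]]]]; rewrite linear_sum big1 // => i _.
  by rewrite linearZ /= Se scaler0.
pose h (q : quotmod S) : V := f (repr q).
have hpi u : h (quotmod_pi S u) = f u.
  apply/eqP; rewrite -subr_eq0 -linearB; apply/eqP/kerf.
  by rewrite -pi_quotmodE reprK.
have surj q : exists u, q = quotmod_pi S u by exact: quotmod_surj.
have lh : linear h.
  move=> a p q; have [u ->] := surj p; have [v ->] := surj q.
  by rewrite -linearP !hpi linearP.
pose hL := GRing.isLinear.Build R (quotmod S) V *:%R h lh.
exists (HB.pack_for {linear (quotmod S) -> V} h hL).
have [g gP] := choice fsurj.
exists (fun v => quotmod_pi S (g v)) => [q|v] /=; last by rewrite hpi.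
have [u ->] := surj q; rewrite hpi; apply/eqP; rewrite pi_quotmodE.
by apply: span_incl; rewrite /S linearB /= gP subrr.
Qed.

Lemma finitely_generated_prod U V : finitely_generated U ->
  finitely_generated V -> finitely_generated (U * V)%type.
Proof.
move=> [m [e eP]] [k [e' eP']].
pose E (i : 'I_(m + k)) : U * V :=
  match fintype.split i with inl j => (e j, 0) | inr j => (0, e' j) end.
exists (m + k)%N, E => -[u v].
have -> : (u, v) = (u, 0) + (0, v) by congr (_, _); rewrite /= ?addr0 ?add0r.
apply: rpredD.
  have /spanP[n [d [c [dP ->]]]] := eP u.
  have -> : (\sum_(i < n) c i *: d i, 0) = \sum_(i < n) c i *: (d i, 0) :> U * V.
    elim/big_rec2: _ => [//|i _ x _ <-]; congr (_, _) => /=.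
    by rewrite scaler0 addr0.
  apply: rpred_sum => i _; apply: rpredZ; apply: span_incl.
  have [j _ <-] := dP i; exists (lshift k j) => //.
  by rewrite /E (unsplitK (inl j)).
have /spanP[n [d [c [dP ->]]]] := eP' v.
have -> : (0, \sum_(i < n) c i *: d i) = \sum_(i < n) c i *: (0, d i) :> U * V.
  elim/big_rec2: _ => [//|i _ x _ <-]; congr (_, _) => /=.
  by rewrite scaler0 addr0.
apply: rpred_sum => i _; apply: rpredZ; apply: span_incl.
have [j _ <-] := dP i; exists (rshift m j) => //.
by rewrite /E (unsplitK (inr j)).
Qed.

Lemma finitely_generated_rV0 : finitely_generated 'rV[R]_0.
Proof. by exists 0%N, (fun=> 0) => v; rewrite [v]thinmx0 rpred0. Qed.

Definition fgmod_prod (N N' : fgmodType R) : fgmodType R :=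
  FgMod (finitely_generated_prod (fgmodP N) (fgmodP N')).
Definition fgmod0 : fgmodType R := FgMod finitely_generated_rV0.

End Isomorphic.

Section IsoClass.
Context (R : nzRingType).
Implicit Types N : fgmodType R.

(* To keep isomorphism classes small, the class of N is recorded as the set  *)
(* of all finite presentations R^n / (S), with S an arbitrary set of         *)
(* relations, that are isomorphic to N.                                      *)
Definition presentation : Type := {n : nat & set 'rV[R]_n}.
Definition presented (P : presentation) : lmodType R := quotmod (projT2 P).

Definition presentations_of (N : lmodType R) : presentation -> Prop :=
  fun P => isomorphic N (presented P).

Definition isoclass :=
  {C : presentation -> Prop | `[< exists N : fgmodType R, C = presentations_of N >]}.
HB.instance Definition _ := SubChoice.on isoclass.

Definition class_of N : isoclass :=
  exist _ (presentations_of N) (asboolT (ex_intro _ N erefl)).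

Lemma class_ofP N N' : class_of N = class_of N' <-> isomorphic N N'.
Proof.
split=> [/(congr1 val)/= eNN'|NN']; last first.
  apply/val_inj/funext => P /=; apply/propext; split.
    exact/isomorphic_trans/isomorphic_sym.
  exact/isomorphic_trans.
have [n [e eP]] := fgmodP N.
pose f (c : 'rV[R]_n) : N := \sum_(i < n) c 0 i *: e i.
have lf : linear f.
  move=> a c d; rewrite /f scaler_sumr -big_split /=; apply: eq_bigr => i _.
  by rewrite !mxE scalerDl scalerA.
pose fL := GRing.isLinear.Build R 'rV[R]_n N *:%R f lf.
pose F := HB.pack_for {linear 'rV[R]_n -> N} f fL.
have Fsurj v : exists c, F c = v.
  have /spanP[k [d [c [dP ->]]]] := eP v.
  elim/big_ind: _ => [|_ _ [x <-] [y <-]|i _].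
  - by exists 0; rewrite linear0.
  - by exists (x + y); rewrite linearD.
  have [j _ <-] := dP i; exists (c i *: delta_mx 0 j).
  rewrite linearZ; congr (_ *: _); rewrite [LHS]/(f _) /f (bigD1 j) //=.
  rewrite mxE !eqxx scale1r big1 ?addr0 // => l /negPf jl.
  by rewrite mxE jl scale0r.
pose P : presentation := existT (fun n => set 'rV[R]_n) n (fun c => F c = 0).
have NP : presentations_of N P by apply/isomorphic_sym/quotmod_kernel.
have := NP; rewrite eNN' => N'P.
exact: isomorphic_trans NP (isomorphic_sym N'P).
Qed.

Fact class_of_surj (C : isoclass) : exists N, C = class_of N.
Proof.
case: C => C CP; have /asboolP[N CN] := CP.
by exists N; apply: val_inj.
Qed.

Definition class_repr (C : isoclass) : fgmodType R :=
  projT1 (cid (class_of_surj C)).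

Lemma class_reprK : cancel class_repr class_of.
Proof. by move=> C; rewrite /class_repr; case: cid. Qed.

Definition class_one : isoclass := class_of (fgmod0 R).
Definition class_mul (C D : isoclass) : isoclass :=
  class_of (fgmod_prod (class_repr C) (class_repr D)).

Lemma class_mulE N N' :
  class_mul (class_of N) (class_of N') = class_of (fgmod_prod N N').
Proof.
apply/class_ofP/isomorphic_prod; apply/class_ofP; exact: class_reprK.
Qed.

Fact class_mulA : associative class_mul.
Proof.
move=> C D E; have [[M ->] [N ->] [P ->]] :=
  And3 (class_of_surj C) (class_of_surj D) (class_of_surj E).
by rewrite !class_mulE; apply/class_ofP/isomorphic_prodA.
Qed.
Fact class_mulC : commutative class_mul.
Proof.
move=> C D; have [[M ->] [N ->]] := conj (class_of_surj C) (class_of_surj D).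
by rewrite !class_mulE; apply/class_ofP/isomorphic_prodC.
Qed.
Fact class_mul1m : left_id class_one class_mul.
Proof.
move=> C; have [N ->] := class_of_surj C.
by rewrite class_mulE; apply/class_ofP/isomorphic_prod0.
Qed.
Fact class_mulm1 : right_id class_one class_mul.
Proof. by move=> C; rewrite class_mulC class_mul1m. Qed.
Fact class_unitm C D :
  class_mul C D = class_one -> C = class_one /\ D = class_one.
Proof.
suff unitl C' D' : class_mul C' D' = class_one -> C' = class_one.
  by move=> CD; split; [apply: unitl CD|apply: (unitl D C); rewrite class_mulC].
have [[M ->] [N ->]] := conj (class_of_surj C') (class_of_surj D').
by rewrite class_mulE => /class_ofP/isomorphic_prod_eq0 M0; apply/class_ofP.
Qed.

HB.instance Definition _ := Choice_isMonomialDef.Build isoclass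
  class_mulA class_mul1m class_mulm1 class_unitm.
HB.instance Definition _ := MonomialDef_isConomialDef.Build isoclass class_mulC.

(* L_0(R-mod), with [N] written L0_class N *)
Definition L0 : comNzRingType := {malg int[isoclass]}.
Definition L0_class N : L0 := << class_of N >>.

Lemma L0_classP N N' : L0_class N = L0_class N' <-> isomorphic N N'.
Proof.
rewrite -class_ofP /L0_class; split=> [|->//].
move=> /(congr1 (monalg.mcoeff (class_of N))).
by rewrite !monalg.mcoeffU eqxx; case: eqP => // ->.
Qed.

Lemma L0_class_mul N N' :
  L0_class N * L0_class N' = L0_class (fgmod_prod N N').
Proof.
by rewrite [LHS]malgM_def fgmulUU mulr1 -[mmul _ _]/(class_mul _ _) class_mulE.
Qed.

End IsoClass.

Section Matroid.
Context (R : idomainType) (n : nat).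
Implicit Types (M : {set 'I_n} -> fgmodType R) (A : {set 'I_n}).

(* The elements b and c are not required to be distinct. *)
Definition is_matroid M : Prop :=
  forall (A : {set 'I_n}) (b c : 'I_n), b \notin A -> c \notin A ->
  exists x y : M A,
    [/\ isomorphic (M (A :|: [set b])) (quotmod [set x]%classic),
        isomorphic (M (A :|: [set c])) (quotmod [set y]%classic) &
        isomorphic (M (A :|: [set b; c])) (quotmod [set x; y]%classic)].

Definition rk M A : nat :=
  (dimension (tensor_fraction (M finset.set0)) - dimension (tensor_fraction (M A)))%N.

Definition rank M : nat := rk M [set: 'I_n].

Definition independent_complex M : {set {set 'I_n}} :=
  [set A | rk M A == #|A|].

Definition dual_torsion M A : lmodType R := dual (tor (M A)).

Definition dual_torsion_fg M : Prop :=
  forall A, finitely_generated (dual_torsion M A).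

Definition dual_torsion_class M (fgM : dual_torsion_fg M) A : L0 R :=
  L0_class (FgMod (fgM A)).

(* 'X_0 and 'X_1 stand for x and y; the truncated subtractions, here and in  *)
(* rk, are exact when M is a matroid. *)
Definition tutte M (fgM : dual_torsion_fg M) : mpoly 2 (L0 R) :=
  \sum_(A : {set 'I_n})
     (dual_torsion_class fgM A)%:MP
     * ('X_0 - 1) ^+ (rank M - rk M A) * ('X_1 - 1) ^+ (#|A| - rk M A).

(* With the usual indexing, f_(i-1) is grothendieck_f fgM i. *)
Definition grothendieck_f M (fgM : dual_torsion_fg M) (i : nat) : L0 R :=
  \sum_(A in independent_complex M | #|A| == i) dual_torsion_class fgM A.

Definition f_polynomial M (fgM : dual_torsion_fg M) : {poly L0 R} :=
  \sum_(i < (rank M).+1) (grothendieck_f fgM i)%:P * ('X - 1) ^+ (rank M - i).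

End Matroid.

(* T(a, b), the coefficients of T being mapped to S by phi. As L0 R need not *)
(* be a domain, it has no field of rational functions: an identity between   *)
(* fractions with denominators t^i and (1 - t)^i is meant in every           *)
(* commutative ring S under L0 R in which t and 1 - t are units, which       *)
(* includes the localization of (L0 R)[t] at t and 1 - t.                    *)
Definition specialize (L : comNzRingType) (S : comNzRingType)
    (phi : {rmorphism L -> S}) (T : mpoly 2 L) (a b : S) : S :=
  mmap phi (tnth [tuple a; b]) T.

(* Main.v *)
Require Import Defs.
From HB Require Import structures.
From mathcomp Require Import all_boot all_order all_algebra.
From mathcomp Require Import fraction.
From mathcomp Require Import boolp classical_sets.
From mathcomp Require Import finmap mpoly monalg.

Set Implicit Arguments.
Unset Strict Implicit.
Unset Printing Implicit Defensive.

Import GRing.Theory.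
Local Open Scope ring_scope.

(** At y = 1 every term of the Tutte polynomial whose exponent |A| - rk(A) of
    y - 1 is positive vanishes, so only the independent sets survive.  Such a
    set A of cardinal i contributes its class times (t - 1)^(r - i), and
    collecting the sets of equal cardinal gives the f-polynomial.  The identity
    with denominators follows by substituting 1/t for t, since
    t / (1 - t) and 1/t - 1 are inverse to each other.  Both identities are
    instances of [specialize_tutte_y1], which computes the value of the Tutte
    polynomial at (a, 1) in any commutative ring under L_0(R-mod).

    The exponents are truncated differences of natural numbers, so this
    argument uses two facts about the rank function of the generic matroid:
    rk(A) <= |A| ([rk_leq_card]), without which terms with |A| < rk(A) would
    survive as well, and rk(A) <= r ([rk_leq_rank]), which puts the cardinal of
    an independent set in the range of summation.  Both follow from how the
    dimension of M(A) ⊗ Q(R) varies: adding one element to A either preserves it or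
    lowers it by one, because M(A + b) is the quotient of M(A) by one element
    ([generic_dimension_setU1]).

    To compare the dimensions of N ⊗ Q(R) and N/(x) ⊗ Q(R), the universal
    property of the tensor product ([tensor_lift]) gives surjective linear maps
    N ⊗ Q -> N/(x) ⊗ Q and N/(x) ⊗ Q -> (N ⊗ Q) / (x ⊗ 1), and the
    quotient of a vector space by one vector loses at most one dimension.  The
    linear algebra reduces to
    comparing numbers of generators: the dimension of a finitely generated
    space is the least number of generators, so that dimensions are bounded by
    exhibiting generators ([dimension_leq]). *)

(** * Dimension as the least number of generators *)

Section Generators.
Context (K : fieldType).
Implicit Types V W : lmodType K.

Definition lincomb V m (e : 'I_m -> V) (c : 'rV[K]_m) : V :=
  \sum_(i < m) c 0 i *: e i.

Definition generates V m (e : 'I_m -> V) : Prop :=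
  forall v, exists c, v = lincomb e c.

Fact lincomb_is_linear V m (e : 'I_m -> V) : linear (lincomb e).
Proof.
move=> a c d; rewrite /lincomb scaler_sumr -big_split /=.
by apply: eq_bigr => i _; rewrite !mxE scalerDl scalerA.
Qed.
HB.instance Definition _ V m (e : 'I_m -> V) :=
  GRing.isLinear.Build K 'rV[K]_m V *:%R (lincomb e) (lincomb_is_linear e).

(** The coordinates of the basis in the generators form a matrix; a linear
    relation between its rows would be one between the basis vectors, so the
    rows are independent. *)
Lemma basis_leq_generators V m k (e : 'I_m -> V) (b : 'I_k -> V) :
  generates e -> is_basis b -> (k <= m)%N.
Proof.
move=> /(_ (b _)) ge bb; have [A bA] := choice ge.
pose B := \matrix_j A j.
have BE c : lincomb b c = lincomb e (c *m B).
  rewrite mulmx_sum_row linear_sum; apply: eq_bigr => j _.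
  by rewrite linearZ /= rowK -bA.
have /eqP <- : row_free B; last exact: rank_leq_col.
apply: inj_row_free => c cB0; have [c0 [_ uniq0]] := bb 0.
rewrite -(uniq0 c) ?(uniq0 0) //; first exact/esym/(linear0 (lincomb b)).
by rewrite -[RHS]/(lincomb b c) BE cB0 linear0.
Qed.

(** A relation with a nonzero coefficient at [e i] eliminates [e i]. *)
Lemma dependent_generators V m (e : 'I_m.+1 -> V) (a : 'rV[K]_m.+1) i :
  generates e -> a 0 i != 0 -> lincomb e a = 0 ->
  generates (fun j => e (lift i j)).
Proof.
move=> ge ai0 a0 v; have [c ->] := ge v.
pose d := c - (c 0 i / a 0 i) *: a.
have -> : lincomb e c = lincomb e d.
  by rewrite linearB linearZ /= a0 scaler0 subr0.
have di0 : d 0 i = 0 by rewrite !mxE divfK ?subrr.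
exists (\row_j d 0 (lift i j)).
rewrite /lincomb (bigD1_ord i) //= di0 scale0r add0r.
by apply: eq_bigr => j _; rewrite mxE.
Qed.

Lemma minimal_generators_basis V m (e : 'I_m -> V) : generates e ->
  (forall k (e' : 'I_k -> V), generates e' -> (m <= k)%N) -> is_basis e.
Proof.
move=> ge mine v; have [c vc] := ge v; exists c; split=> // d vd.
apply/eqP; rewrite -subr_eq0; apply/eqP/rowP => i; rewrite [RHS]mxE.
apply/eqP/negPn/negP => ai0.
case: m e ge mine c d vc vd i ai0 => [|m] e ge mine c d vc vd i ai0.
  by case: i ai0.
suff /(dependent_generators ge ai0)/mine : lincomb e (c - d) = 0.
  by rewrite ltnn.
by rewrite linearB /= -vc -[lincomb e d]vd subrr.
Qed.

(** In the absence of a basis the dimension is the default value 0, and the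
    bound is trivial; otherwise it is the size of a basis. *)
Lemma dimension_leq V m (e : 'I_m -> V) : generates e -> (dimension V <= m)%N.
Proof.
move=> ge; rewrite /dimension; case: xgetP => // k _ [b bb].
exact: basis_leq_generators ge bb.
Qed.

Definition finite_dimensional V : Prop :=
  exists m (e : 'I_m -> V), generates e.

(** A generating family of least size is a basis, so the dimension is the
    size of some basis and not the default value. *)
Lemma dimension_generators V : finite_dimensional V ->
  exists e : 'I_(dimension V) -> V, generates e.
Proof.
move=> fdV; have exm : exists m, `[< exists e : 'I_m -> V, generates e >].
  by have [m fm] := fdV; exists m; apply/asboolP.
case: (ex_minnP exm) => m /asboolP[e ge] minm.
have be : is_basis e.
  by apply: minimal_generators_basis => // k e' ge'; apply/minm/asboolP; exists e'.
have [b bb] : exists b : 'I_(dimension V) -> V, is_basis b.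
  by apply: (@xgetPex _ 0%N [set n | exists e : 'I_n -> V, is_basis e]%classic); exists m, e.
by exists b => v; have [c [vc _]] := bb v; exists c.
Qed.

Lemma linear_lincomb V W (f : {linear V -> W}) m (e : 'I_m -> V) c :
  f (lincomb e c) = lincomb (f \o e) c.
Proof.
by rewrite linear_sum; apply: eq_bigr => i _; rewrite linearZ.
Qed.

Lemma dimension_surj V W (f : {linear V -> W}) : finite_dimensional V ->
  (forall w, exists v, f v = w) -> (dimension W <= dimension V)%N.
Proof.
move=> /dimension_generators[e ge] fsurj; apply: (@dimension_leq _ _ (f \o e)).
move=> w; have [v <-] := fsurj w; have [c ->] := ge v.
by exists c; rewrite linear_lincomb.
Qed.

(** Lifts of generators of the quotient generate V together with [v0]. *)
Lemma dimension_quot1 V (v0 : V) : finite_dimensional V ->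
  (dimension V <= (dimension (quotmod [set v0]%classic)).+1)%N.
Proof.
set W := quotmod _; pose p : {linear V -> W} := quotmod_pi [set v0]%classic.
move=> [m [e ge]].
have psurj w : exists v, p v = w by have [v ->] := quotmod_surj w; exists v.
have [w gw] : exists w : 'I_(dimension W) -> W, generates w.
  apply: dimension_generators; exists m, (p \o e) => w.
  have [v <-] := psurj w; have [c ->] := ge v.
  by exists c; rewrite linear_lincomb.
have [l lP] := choice psurj.
pose e' i := if unlift ord0 i is Some j then l (w j) else v0.
apply: (@dimension_leq _ _ e') => v.
have [c pv] := gw (p v).
have : p v = p (lincomb (l \o w) c).
  by rewrite pv linear_lincomb; apply: eq_bigr => i _ /=; rewrite lP.
move/eqP; rewrite pi_quotmodE => /spanP[k [x [d [xv0 vE]]]].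
pose a := \sum_(i < k) d i.
have {}vE : v = a *: v0 + lincomb (l \o w) c.
  rewrite scaler_suml -[LHS](subrK (lincomb (l \o w) c)) vE; congr (_ + _).
  by apply: eq_bigr => i _; rewrite (xv0 i).
exists (\row_i if unlift ord0 i is Some j then c 0 j else a).
rewrite vE /lincomb big_ord_recl /e' mxE unlift_none; congr (_ + _).
by apply: eq_bigr => i _; rewrite mxE liftK.
Qed.

End Generators.

(** * Linear maps out of quotients and free modules *)

Lemma quotmod_pi_surj (R : nzRingType) (V : lmodType R) (S : set V) q :
  exists v, q = quotmod_pi S v.
Proof. exact: quotmod_surj. Qed.

Lemma quotmod_lift (R : nzRingType) (V W : lmodType R) (S : set V)
    (f : {linear V -> W}) : (forall v, S v -> f v = 0) ->
  exists g : {linear quotmod S -> W}, forall v, g (quotmod_pi S v) = f v.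
Proof.
move=> fS; pose h (q : quotmod S) : W := f (repr q).
have hpi v : h (quotmod_pi S v) = f v.
  have : quotmod_pi S (repr (quotmod_pi S v)) == quotmod_pi S v.
    by apply/eqP; rewrite /quotmod_pi reprK.
  rewrite pi_quotmodE => /spanP[n [e [c [Se /(congr1 f)/eqP]]]].
  rewrite linear_sum big1 => [|i _]; last by rewrite linearZ /= fS ?scaler0.
  by rewrite linearB subr_eq0 => /eqP.
have lh : linear h.
  move=> a p q; have [u ->] := quotmod_pi_surj p; have [v ->] := quotmod_pi_surj q.
  by rewrite -linearP !hpi linearP.
pose hL := GRing.isLinear.Build R (quotmod S) W *:%R h lh.
by exists (HB.pack_for {linear quotmod S -> W} h hL).
Qed.

Section LinearExtension.
Context (R : nzRingType) (T : choiceType) (W : lmodType R) (g : T -> W).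

Definition malg_extend (x : {malg R[T]}) : W :=
  \sum_(k <- enum_fset (msupp x)) mcoeff k x *: g k.

(** The sum may run over any finite set containing the support, which lets
    the sums for x, y and a x + y share their index set. *)
Lemma malg_extendE (d : {fset T}) x : fsubset (msupp x) d ->
  malg_extend x = \sum_(k <- enum_fset d) mcoeff k x *: g k.
Proof.
move=> xd; rewrite /malg_extend; apply/big_fset_incl => //= k _ kx.
by rewrite mcoeff_outdom // scale0r.
Qed.

Fact malg_extend_is_linear : linear malg_extend.
Proof.
move=> a x y; pose d := (msupp x `|` msupp y)%fset.
rewrite !(@malg_extendE d) ?fsubsetUl ?fsubsetUr //.
  rewrite scaler_sumr -big_split /=; apply: eq_bigr => k _.
  by rewrite mcoeffD mcoeffZ scalerDl scalerA.
apply: fsubset_trans (msuppD_le _ _) _.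
exact: fsetSU (msuppZ_le _ _).
Qed.
HB.instance Definition _ :=
  GRing.isLinear.Build R {malg R[T]} W *:%R malg_extend malg_extend_is_linear.

Lemma malg_extendU k : malg_extend << k >> = g k.
Proof.
rewrite (@malg_extendE [fset k]%fset) ?msuppU_le //.
by rewrite big_seq_fset1 mcoeffUU scale1r.
Qed.

End LinearExtension.

(** * The universal property of the tensor product with the fraction field *)

Section TensorFraction.
Context (R : idomainType).
Local Notation Q := {fraction R}.
Implicit Types N : lmodType R.

(** The R-linear maps from N to a Q(R)-space W, written without restricting
    the scalars of W to R. *)
Definition semilinear_frac N (W : lmodType Q) (g : N -> W) : Prop :=
  {morph g : u v / u + v} /\ forall a u, g (a *: u) = tofrac a *: g u.

(** The pure tensor u ⊗ 1; since u ⊗ q = q (u ⊗ 1), these generate. *)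
Definition pure N (u : N) : tensor_fraction N :=
  quotmod_pi (@tensor_rel R N) (tensor_symb u 1).

Lemma tensor_rel0 N x : @tensor_rel R N x -> quotmod_pi (@tensor_rel R N) x = 0.
Proof.
move=> relx; rewrite -(linear0 (quotmod_pi (@tensor_rel R N))).
by apply/eqP; rewrite pi_quotmodE subr0; apply: span_incl.
Qed.

Lemma tensor_symbE N (u : N) q :
  quotmod_pi (@tensor_rel R N) (tensor_symb u q) = q *: pure u.
Proof.
have := tensor_rel0 (TensorM q u 1).
by rewrite mulr1 linearB linearZ => /eqP; rewrite subr_eq0 => /eqP.
Qed.

Lemma pure_semilinear N : semilinear_frac (@pure N).
Proof.
split=> [u v|a u].
  have := tensor_rel0 (TensorDl u v 1).
  by rewrite !linearB -addrA -opprD => /eqP; rewrite subr_eq0 => /eqP.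
have := tensor_rel0 (TensorZ a u 1).
by rewrite mulr1 linearB [X in _ - X]tensor_symbE => /eqP; rewrite subr_eq0 => /eqP.
Qed.

Lemma tensor_ind N (P : tensor_fraction N -> Prop) : P 0 ->
  (forall q u x, P x -> P (q *: pure u + x)) -> forall x, P x.
Proof.
move=> P0 PD x; have [y ->] := quotmod_pi_surj x.
rewrite (monalgE y) linear_sum.
elim/big_rec: _ => // -[u q] z _ Pz.
suff -> : (<< mcoeff (u, q) y *g (u, q) >>)%R = mcoeff (u, q) y *: tensor_symb u q.
  by rewrite linearZ /= tensor_symbE scalerA; apply: PD.
by apply/malgP => k; rewrite mcoeffZ !mcoeffU mulrnAr mulr1.
Qed.

Lemma tensor_lift N (W : lmodType Q) (g : N -> W) : semilinear_frac g ->
  exists G : {linear tensor_fraction N -> W}, forall u, G (pure u) = g u.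
Proof.
move=> [gD gZ]; pose h (w : N * Q) := w.2 *: g w.1.
have hE u q : malg_extend h (tensor_symb u q) = q *: g u by exact: malg_extendU.
have [|G GE] := @quotmod_lift _ _ _ (@tensor_rel R N) (malg_extend h); last first.
  by exists G => u; rewrite GE /= hE scale1r.
have hB x y a b : malg_extend h x = a -> malg_extend h y = b ->
    malg_extend h (x - y) = a - b by move=> <- <-; rewrite linearB.
have hZ c x a : malg_extend h x = a -> malg_extend h (c *: x) = c *: a.
  by move=> <-; rewrite linearZ.
move=> _ [u v q|u p q|a u q|p u q].
- apply: etrans (hB _ _ _ _ (hB _ _ _ _ (hE _ _) (hE _ _)) (hE _ _)) _.
  by rewrite gD scalerDr -addrA -opprD subrr.
- apply: etrans (hB _ _ _ _ (hB _ _ _ _ (hE _ _) (hE _ _)) (hE _ _)) _.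
  (* Only this scaling identity is used about p + q, so it becomes a variable. *)
  move: (p + q) (scalerDl (g u) p q) => r ->.
  by rewrite -addrA -opprD subrr.
- apply: etrans (hB _ _ _ _ (hE _ _) (hE _ _)) _; apply/eqP; rewrite subr_eq0.
  by rewrite gZ scalerA; apply/eqP; congr (_ *: _); apply: mulrC.
- apply: etrans (hB _ _ _ _ (hE _ _) (hZ _ _ _ (hE _ _))) _.
  by rewrite scalerA subrr.
Qed.

End TensorFraction.

(** * Dimension of the generic fibre of a module and of its quotients *)

Section TensorDimension.
Context (R : idomainType).
Implicit Types N : lmodType R.

Lemma tensor_finite_dimensional N :
  finitely_generated N -> finite_dimensional (tensor_fraction N).
Proof.
move=> [m [e eP]]; exists m, (fun i => pure (e i)).
have [pD pZ] := @pure_semilinear R N.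
have p0 : pure (0 : N) = 0 by apply: (addrI (pure 0)); rewrite -pD !addr0.
suff pureP u : exists c, pure u = lincomb (fun i => pure (e i)) c.
  elim/tensor_ind => [|q u x [c ->]]; first by exists 0; rewrite linear0.
  by have [d ->] := pureP u; exists (q *: d + c); rewrite linearP.
have /spanP[k [x [c [xe ->]]]] := eP u.
elim/big_ind: _ => [|v w [d dv] [d' dw]|i _]; first by exists 0; rewrite linear0.
  by exists (d + d'); rewrite pD linearD /= dv dw.
have [j _ <-] := xe i; exists (tofrac (c i) *: delta_mx 0 j).
rewrite pZ linearZ; congr (_ *: _); rewrite /= /lincomb (bigD1 j) //=.
rewrite mxE !eqxx scale1r big1 ?addr0 // => l /negPf jl.
by rewrite mxE jl scale0r.
Qed.

Lemma tensor_dimension_surj N N' (f : {linear N -> N'}) :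
  finitely_generated N -> (forall v, exists u, f u = v) ->
  (dimension (tensor_fraction N') <= dimension (tensor_fraction N))%N.
Proof.
move=> fgN fsurj; have [pD pZ] := @pure_semilinear R N'.
have [|F FE] := @tensor_lift R N (tensor_fraction N') (fun u => pure (f u)).
  by split=> [u v|a u]; [rewrite linearD pD | rewrite linearZ pZ].
apply: (dimension_surj (f := F)); first exact: tensor_finite_dimensional.
move=> w; elim/tensor_ind: w => [|q v x [y <-]]; first by exists 0; rewrite linear0.
have [u <-] := fsurj v; exists (q *: pure u + y).
by rewrite linearP /= FE.
Qed.

Lemma tensor_dimension_iso N N' : finitely_generated N ->
  finitely_generated N' -> isomorphic N N' ->
  dimension (tensor_fraction N) = dimension (tensor_fraction N').
Proof.
move=> fgN fgN' NN'; apply/eqP; rewrite eqn_leq; apply/andP; split.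
  have [f [g _ gK]] := isomorphic_sym NN'.
  by apply: (tensor_dimension_surj (f := f)) => // v; exists (g v).
have [f [g _ gK]] := NN'.
by apply: (tensor_dimension_surj (f := f)) => // v; exists (g v).
Qed.

Lemma finitely_generated_quot N (S : set N) :
  finitely_generated N -> finitely_generated (quotmod S).
Proof.
move=> [m [e eP]]; exists m, (fun i => quotmod_pi S (e i)) => q.
have [u ->] := quotmod_pi_surj q; have /spanP[k [x [c [xe ->]]]] := eP u.
rewrite linear_sum; apply: rpred_sum => i _; rewrite linearZ; apply: rpredZ.
by apply: span_incl; have [j _ <-] := xe i; exists j.
Qed.

(** The map u |-> u ⊗ 1 from N to (N ⊗ Q) / (x ⊗ 1) kills [x], so it factors
    through N/(x) and induces a surjection from N/(x) ⊗ Q. *)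
Lemma tensor_dimension_quot1 N (x : N) : finitely_generated N ->
  (dimension (tensor_fraction N)
     <= (dimension (tensor_fraction (quotmod [set x]%classic))).+1)%N.
Proof.
move=> fgN; have fdN := tensor_finite_dimensional fgN.
apply: leq_trans (dimension_quot1 (pure x) fdN) _; rewrite ltnS.
set W : lmodType {fraction R} := quotmod [set pure x]%classic.
set N1 : lmodType R := quotmod [set x]%classic.
pose p : {linear tensor_fraction N -> W} := quotmod_pi [set pure x]%classic.
have [pD pZ] := @pure_semilinear R N.
have px : p (pure x) = 0.
  rewrite -(linear0 p).
  by apply/eqP; rewrite pi_quotmodE subr0; apply: span_incl.
have p_pure u v : quotmod_pi [set x]%classic u = quotmod_pi [set x]%classic v ->
    p (pure u) = p (pure v).
  move=> /eqP; rewrite pi_quotmodE => /spanP[k [e [c [ex uv]]]].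
  rewrite -[u](subrK v) uv pD linearD.
  rewrite [X in X + _](_ : _ = 0) ?add0r //.
  elim/big_ind: _ => [|y z y0 z0|i _].
  - by rewrite -(scale0r (0 : N)) pZ rmorph0 scale0r linear0.
  - by rewrite pD linearD /= y0 z0 addr0.
  - by rewrite ex pZ linearZ /= px scaler0.
have [l lP] := choice (@quotmod_pi_surj R N [set x]%classic).
have [|G GE] := @tensor_lift R N1 W (fun q => p (pure (l q))).
  split=> [q q'|a q].
    by rewrite -linearD /= -pD; apply: p_pure; rewrite -lP linearD /= -!lP.
  by rewrite -linearZ /= -pZ; apply: p_pure; rewrite -lP linearZ /= -!lP.
apply: (dimension_surj (f := G)).
  exact/tensor_finite_dimensional/finitely_generated_quot.
move=> w; have [v ->] := quotmod_pi_surj w; elim/tensor_ind: v => [|q u y [z zE]].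
  by exists 0; rewrite !linear0.
have Gu : G (pure (quotmod_pi [set x]%classic u : N1)) = p (pure u).
  by rewrite GE; apply: p_pure; rewrite -lP.
exists (q *: pure (quotmod_pi [set x]%classic u) + z).
by rewrite (linearP G) Gu zE (linearP p).
Qed.

End TensorDimension.

(** * The rank function and the Tutte polynomial at y = 1 *)

Lemma specialize_term (L S : comNzRingType) (phi : {rmorphism L -> S}) (a b : S)
    (c : L) k l :
  specialize phi (c%:MP_[2] * ('X_0 - 1) ^+ k * ('X_1 - 1) ^+ l) a b
  = phi c * (a - 1) ^+ k * (b - 1) ^+ l.
Proof.
rewrite /specialize !rmorphM !rmorphXn !rmorphB !rmorph1 /=.
by rewrite mpoly.mmapC !mmapX !mmap1U !(tnth_nth 0).
Qed.

Section GenericMatroid.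
Context (R : idomainType) (n : nat) (M : {set 'I_n} -> fgmodType R).
Context (matM : is_matroid M).
Implicit Types A B : {set 'I_n}.

Let d A := dimension (tensor_fraction (M A)).

(** Taking c = b in the matroid axiom presents M(A + b) as M(A)/(x). *)
Lemma generic_dimension_setU1 A b : b \notin A ->
  (d (b |: A) <= d A <= (d (b |: A)).+1)%N.
Proof.
move=> bA; have [x [_ [Mx _ _]]] := matM bA bA; rewrite finset.setUC.
have fgx := finitely_generated_quot [set x]%classic (fgmodP (M A)).
rewrite /d (tensor_dimension_iso (fgmodP _) fgx Mx).
rewrite tensor_dimension_quot1 ?andbT; last exact: fgmodP.
apply: (tensor_dimension_surj (f := quotmod_pi [set x]%classic)).
  exact: fgmodP.
by move=> q; have [u ->] := quotmod_pi_surj q; exists u.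
Qed.

Lemma generic_dimension_subset A B : A \subset B -> (d B <= d A)%N.
Proof.
elim: {B}_.+1 {-2}B (ltnSn #|B|) => // k IHk B Bk AB.
have [->//|] := eqVneq A B; rewrite finset.eqEsubset AB /= => /fintype.subsetPn[b bB bA].
have bB' : b \notin B :\ b by rewrite finset.setD11.
have /andP[+ _] := generic_dimension_setU1 bB'; rewrite finset.setD1K // => /leq_trans.
apply; apply: IHk; first by move: Bk; rewrite (finset.cardsD1 b) bB add1n !ltnS.
by rewrite finset.subsetD1 AB bA.
Qed.

(** Removing the elements of A one by one, each step costs at most 1. *)
Lemma generic_dimension_card A : (d finset.set0 <= d A + #|A|)%N.
Proof.
elim: {A}_.+1 {-2}A (ltnSn #|A|) => // k IHk A Ak.
have [->|[b bA]] := finset.set_0Vmem A; first by rewrite leq_addr.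
have bA' : b \notin A :\ b by rewrite finset.setD11.
have /andP[_] := generic_dimension_setU1 bA'; rewrite finset.setD1K // => dA.
rewrite (finset.cardsD1 b) bA addnA addn1.
apply: leq_trans (IHk (A :\ b) _) _; last by rewrite leq_add2r.
by move: Ak; rewrite (finset.cardsD1 b) bA add1n !ltnS.
Qed.

Lemma rk_leq_card A : (rk M A <= #|A|)%N.
Proof. by rewrite leq_subLR generic_dimension_card. Qed.

Lemma rk_leq_rank A : (rk M A <= rank M)%N.
Proof. by rewrite leq_sub2l // generic_dimension_subset // finset.subsetT. Qed.

(** The term of A has a factor 0 ^+ (|A| - rk A), which by [rk_leq_card] is
    the indicator of independence.  By [rk_leq_rank] the cardinal of an
    independent set is at most the rank, so grouping by cardinal loses none. *)
Lemma specialize_tutte_y1 (fgM : dual_torsion_fg M) (S : comNzRingType)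
    (phi : {rmorphism L0 R -> S}) (a : S) :
  specialize phi (tutte fgM) a 1
  = \sum_(i < (rank M).+1) phi (grothendieck_f fgM i) * (a - 1) ^+ (rank M - i).
Proof.
pose c A : S := phi (dual_torsion_class fgM A).
have termE A : specialize phi ((dual_torsion_class fgM A)%:MP_[2]
     * ('X_0 - 1) ^+ (rank M - rk M A) * ('X_1 - 1) ^+ (#|A| - rk M A)) a 1
   = if A \in independent_complex M then c A * (a - 1) ^+ (rank M - #|A|) else 0.
  rewrite specialize_term subrr expr0n subn_eq0.
  rewrite finset.inE eqn_leq rk_leq_card /=.
  case: leqP => [cA|]; last by rewrite mulr0.
  (* An exponent 0 of y - 1 means #|A| <= rk M A, hence equality. *)
  by rewrite mulr1 /c; have/eqP<- : rk M A == #|A| by rewrite eqn_leq rk_leq_card.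
rewrite /specialize /tutte raddf_sum (eq_bigr _ (fun A _ => termE A)) -big_mkcond.
(* For independent A, #|A| = rk M A <= rank M, so inord #|A| has value #|A|. *)
rewrite /= (partition_big (fun A => inord #|A| : 'I_(rank M).+1) xpredT) //=.
apply: eq_bigr => i _; rewrite raddf_sum mulr_suml.
apply: eq_big => [A|A /andP[indA /eqP <-]].
  case indA : (A \in _) => //=; rewrite -val_eqE /= inordK // ltnS.
  by move: indA; rewrite finset.inE => /eqP <-; apply: rk_leq_rank.
rewrite inordK // ltnS.
by move: indA; rewrite finset.inE => /eqP <-; apply: rk_leq_rank.
Qed.

End GenericMatroid.

Theorem theorem3p2 (R : idomainType) (n : nat)
    (M : {set 'I_n} -> fgmodType R) (matM : is_matroid M)
    (fgM : dual_torsion_fg M) :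
  let r := rank M in
  let T := tutte fgM in
  let f := grothendieck_f fgM in
  specialize polyC T 'X 1 = f_polynomial fgM
  /\ forall (S : comUnitRingType) (phi : {rmorphism L0 R -> S}) (t : S),
       t \is a GRing.unit -> 1 - t \is a GRing.unit ->
       t ^+ r / (1 - t) ^+ r * specialize phi T t^-1 1
       = \sum_(i < r.+1) phi (f i) * (t ^+ i / (1 - t) ^+ i).
Proof.
move=> r T f; split=> [|S phi t tU t1U]; rewrite (specialize_tutte_y1 matM) //.
rewrite mulr_sumr; apply: eq_bigr => i _; rewrite mulrCA; congr (_ * _).
have -> : t^-1 - 1 = (1 - t) / t by rewrite mulrBl mul1r divrr.
rewrite /r; move: (nat_of_ord i) (leq_ord i) => j /subnKC.
move: (rank M - j)%N => k <-.
rewrite -!exprVn -!exprMn exprD -mulrA -exprMn mulrA divrK //.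
by rewrite divrr // expr1n mulr1.
Qed.
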